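(* Let $m,n\ge 1$, $\mathbf{A}=[A_{ij}]\in\mathbb{R}^{m\times n}$, $\mathbf{b}\in\mathbb{R}^m$, $J=\{1,\dots,n\}$, $0<p<\infty$ and $\epsilon\ge 0$. Suppose the greedy algorithm described in the context, run on this input, returns a vector $\mathbf{x}$ with support set $T_k$ after $k>0$ iterations of its while loop. Let $T^*$ be the support set of an optimal solution of the problem $$\min_{\mathbf{x}\in\mathbb{R}_{\max}^n}|\mathrm{supp}(\mathbf{x})|\quad\text{s.t.}\quad \|\mathbf{b}-\mathbf{A}\boxplus\mathbf{x}\|_p^p\le\epsilon,\quad \mathbf{A}\boxplus\mathbf{x}\le\mathbf{b}.$$ Then $$\frac{|T_k|}{|T^*|}\le 1+\log\left(\frac{m\Delta^p-\epsilon}{E_p(T_{k-1})-\epsilon}\right),\qquad \Delta=\max_{i,j}(b_i-A_{ij}-\hat x_j).$$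
   Context: $\mathbb{R}_{\max}=\mathbb{R}\cup\{-\infty\}$. For $\mathbf{x}\in\mathbb{R}_{\max}^n$, $[\mathbf{A}\boxplus\mathbf{x}]_i=\max_{1\le j\le n}(A_{ij}+x_j)$ and $\mathrm{supp}(\mathbf{x})=\{j: x_j\neq-\infty\}$. Inequalities between vectors are componentwise. $\|\mathbf{v}\|_p^p=\sum_i|v_i|^p$, with value $+\infty$ if some entry is infinite (here $b_i-(-\infty)=+\infty$). $\log$ is the natural logarithm. The principal solution is $\hat{\mathbf{x}}\in\mathbb{R}^n$ with $\hat x_j=\min_{1\le i\le m}(b_i-A_{ij})$. For $T\subseteq J$ define $e_i(T)=b_i-\max_{j\in T}(A_{ij}+\hat x_j)$ if $T\ne\emptyset$, $e_i(\emptyset)=\max_{j\in J}e_i(\{j\})$, and $E_p(T)=\sum_{i=1}^m(e_i(T))^p$. Greedy algorithm: compute $\hat{\mathbf{x}}$. If $E_p(J)>\epsilon$, return ''Infeasible''. Otherwise set $T_0=\emptyset$, $k=0$. While $E_p(T_k)>\epsilon$: choose $j\in\arg\min_{s\in J\setminus T_k}E_p(T_k\cup\{s\})$, set $T_{k+1}=T_k\cup\{j\}$, and increase $k$ by $1$. When the loop ends, return $T_k$ and the vector $\mathbf{x}$ with $x_j=\hat x_j$ for $j\in T_k$ and $x_j=-\infty$ otherwise. Thus $k$ in the claim is the total number of iterations performed, and $T_{k-1}$ is the set before the last iteration. *)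

(* Defs.v *)
From mathcomp Require Import all_boot all_order all_algebra.
From mathcomp Require Import reals constructive_ereal exp.

Set Implicit Arguments.
Unset Strict Implicit.
Unset Printing Implicit Defensive.

Import Order.TTheory GRing.Theory Num.Theory.
Local Open Scope ring_scope.

(* Maximum and minimum of a finite family of reals indexed by D.  The bounds
   -oo and +oo only matter for empty D; for nonempty D these are a genuine
   maximum and minimum, see fmaxP and fminP. *)
Definition fmax (R : realType) (I : finType) (D : {set I}) (f : I -> R) : R :=
  fine (\big[maxe/-oo%E]_(i in D) (f i)%:E).

Definition fmin (R : realType) (I : finType) (D : {set I}) (f : I -> R) : R :=
  fine (\big[mine/+oo%E]_(i in D) (f i)%:E).

Lemma fmaxP (R : realType) (I : finType) (D : {set I}) (f : I -> R) :
  D != set0 ->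
  (exists2 i, i \in D & fmax D f = f i) /\ (forall i, i \in D -> f i <= fmax D f).
Proof.
case/set0Pn => i0 i0D.
have [i iD Ei] : exists2 i, i \in D &
    (\big[maxe/-oo%E]_(i in D) (f i)%:E = (f i)%:E)%E.
  case: (@eq_bigmax _ _ I -oo%E i0 (mem D) (fun i => (f i)%:E) i0D).
    by move=> i _; exact: leNye.
  by move=> i iD ->; exists i.
have Em : fmax D f = f i by rewrite /fmax Ei.
split; first by exists i.
by move=> j jD; rewrite -lee_fin Em -Ei; exact: le_bigmax_cond.
Qed.

Lemma fminP (R : realType) (I : finType) (D : {set I}) (f : I -> R) :
  D != set0 ->
  (exists2 i, i \in D & fmin D f = f i) /\ (forall i, i \in D -> fmin D f <= f i).
Proof.
case/set0Pn => i0 i0D.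
have [i iD Ei] : exists2 i, i \in D &
    (\big[mine/+oo%E]_(i in D) (f i)%:E = (f i)%:E)%E.
  case: (@eq_bigmin _ _ I +oo%E i0 (mem D) (fun i => (f i)%:E) i0D).
    by move=> i _; exact: leey.
  by move=> i iD ->; exists i.
have Em : fmin D f = f i by rewrite /fmin Ei.
split; first by exists i.
by move=> j jD; rewrite -lee_fin Em -Ei; exact: bigmin_le_cond.
Qed.

Section Problem.
Context {R : realType} {m n : nat}.
Implicit Types (A : 'M[R]_(m, n)) (b : 'cV[R]_m) (p eps : R).
Implicit Types (x : 'cV[\bar R]_n) (T : {set 'I_n}).

(* Vectors over R_max = R U {-oo} are extended real vectors avoiding +oo. *)
Definition in_Rmax x : Prop := forall j, x j 0 != +oo%E.

Definition supp x : {set 'I_n} := [set j | x j 0 != -oo%E].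

Definition maxplus_mul A x : 'cV[\bar R]_m :=
  \col_(i < m) \big[maxe/-oo%E]_(j < n) ((A i j)%:E + x j 0%R)%E.

Definition pnorm_pow p (v : 'cV[\bar R]_m) : \bar R :=
  (\sum_(i < m) `|v i 0%R| `^ p)%E.

Definition feasible A b p eps x : Prop :=
  [/\ in_Rmax x,
      (pnorm_pow p (\col_(i < m) ((b i 0%R)%:E - maxplus_mul A x i 0%R)%E) <= eps%:E)%E
    & forall i, (maxplus_mul A x i 0%R <= (b i 0%R)%:E)%E].

Definition optimal A b p eps x : Prop :=
  feasible A b p eps x /\
  forall y, feasible A b p eps y -> (#|supp x| <= #|supp y|)%N.

Definition principal A b : 'cV[R]_n :=
  \col_(j < n) fmin [set: 'I_m] (fun i => b i 0 - A i j).

Definition err_nonempty A b (i : 'I_m) T : R :=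
  b i 0 - fmax T (fun j => A i j + principal A b j 0).

Definition err A b (i : 'I_m) T : R :=
  if T == set0 then fmax [set: 'I_n] (fun j => err_nonempty A b i [set j])
  else err_nonempty A b i T.

Definition total_err A b p T : R := \sum_(i < m) err A b i T `^ p.

Definition max_gap A b : R :=
  fmax [set: 'I_m * 'I_n]
    (fun ij => b ij.1 0 - A ij.1 ij.2 - principal A b ij.2 0).

(* One iteration of the while loop: the guard holds and T' adds to T some
   minimiser (ties may be broken arbitrarily). *)
Definition greedy_step A b p eps T T' : Prop :=
  eps < total_err A b p T /\
  exists2 j, j \notin T &
    (forall s, s \notin T -> total_err A b p (j |: T) <= total_err A b p (s |: T))
    /\ T' = j |: T.

(* A run that does not answer "Infeasible" and returns (Ts k, x) after exactly
   k iterations, going through the sets Ts 0, ..., Ts k; the values of Ts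
   beyond k are irrelevant. *)
Definition greedy_returns A b p eps (Ts : nat -> {set 'I_n}) (k : nat) x : Prop :=
  [/\ total_err A b p [set: 'I_n] <= eps,
      Ts 0%N = set0,
      forall l, (l < k)%N -> greedy_step A b p eps (Ts l) (Ts l.+1),
      total_err A b p (Ts k) <= eps
    & x = \col_(j < n) (if j \in Ts k then (principal A b j 0)%:E else -oo%E)].

End Problem.

(* Main.v *)
Require Import Defs.
From mathcomp Require Import all_boot all_order all_algebra.
From mathcomp Require Import reals constructive_ereal exp.
From mathcomp Require Import lra.
Import Order.TTheory GRing.Theory Num.Theory.
Local Open Scope ring_scope.

(** Write E for the error [total_err], t for the size of the optimal support
    T*, and d l = E (T l) - eps for the excess error before iteration l.

    Row by row, the error of a nonempty set S is the minimum over j in S of the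
    gaps b i - A i j - xhat j, and the error of the empty set is their maximum,
    so enlarging a set never increases an error.  If j in S attains the minimum
    for S in row i, then adding that single j to any set T already brings the
    error in row i down to the error of S or below.  The drop from T to S in
    row i, measured on p-th powers, is therefore at most the drop caused by one
    element of S, and a fortiori at most the sum of the drops caused by all of
    them.  Summing over the rows gives [total_err_drop]:
    E T - E S <= sum over j in S of (E T - E (T + j)).

    The support of a feasible vector is nonempty and has error at most eps
    ([feasible_supp]): a feasible vector lies below the principal solution, and
    raising its finite entries to the principal values shrinks the residual.
    With S = T* and T = T l, where E T* <= eps, each of the t terms is at most
    the drop of the greedy choice, whence d l <= t (d l - d (l + 1)).  Since
    ln y <= y - 1, every step of the run but the last lowers ln d by at least
    1 / t ([ln_decay]).  Hence (k - 1) / t <= ln (d 0 / d (k - 1)), and the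
    claim follows from |T k| = k, 1 / t <= 1 and E (T 0) <= m Delta^p. *)

(** The hypothesis says that [d] shrinks at least by the factor 1 - 1/t at each
    step, so ln d decreases by at least 1/t, as ln (1 - 1/t) <= - 1/t.  The
    indices stop short of [k] because the last step of a greedy run may
    overshoot and make [d] nonpositive. *)
Lemma ln_decay (R : realType) (d : nat -> R) (t : R) (k : nat) :
  0 < t -> (forall l, (l < k)%N -> 0 < d l) ->
  (forall l, (l.+1 < k)%N -> d l <= t * (d l - d l.+1)) ->
  forall l, (l < k)%N -> l%:R / t <= ln (d 0%N) - ln (d l).
Proof.
move=> t0 dpos step; elim=> [|l IH] lk; first by rewrite mul0r subrr.
have dl := dpos _ (ltnW lk); have dSl := dpos _ lk.
have ratio : d l.+1 / d l - 1 <= - t^-1.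
  rewrite lerBlDr ler_pdivrMr// -(ler_pM2l t0) mulrA mulrDr mulrN divff ?gt_eqF//.
  have := step _ lk; lra.
have : ln (d l.+1) - ln (d l) <= - t^-1.
  rewrite -ln_div ?posrE//; apply: le_trans ratio.
  have q0 : 0 < d l.+1 / d l by rewrite divr_gt0.
  by rewrite -{1}(subrK 1 (d l.+1 / d l)) addrC le_ln1Dx// ltrBrDr addNr.
have := IH (ltnW lk); rewrite -natr1 mulrDl mul1r; lra.
Qed.

Section Errors.
Context {R : realType} {m n : nat}.
Context (A : 'M[R]_(m, n)) (b : 'cV[R]_m).
Implicit Types (p eps : R) (i : 'I_m) (j : 'I_n) (S T : {set 'I_n}).

Definition gap i j : R := b i 0 - A i j - principal A b j 0.

Lemma principal_le i j : principal A b j 0 <= b i 0 - A i j.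
Proof.
have m0 : [set: 'I_m] != set0 by apply/set0Pn; exists i; rewrite inE.
by rewrite mxE; have [_] := fminP (fun i => b i 0 - A i j) m0; apply; rewrite inE.
Qed.

Lemma gap_ge0 i j : 0 <= gap i j.
Proof. by rewrite subr_ge0 principal_le. Qed.

Lemma gap_le_max_gap i j : gap i j <= max_gap A b.
Proof.
have mn0 : [set: 'I_m * 'I_n] != set0 by apply/set0Pn; exists (i, j); rewrite inE.
have [_ H] := fmaxP (fun ij : 'I_m * 'I_n =>
  b ij.1 0 - A ij.1 ij.2 - principal A b ij.2 0) mn0.
by have := H (i, j); rewrite inE; apply.
Qed.

Lemma err_nonempty_le i {T j} : j \in T -> err_nonempty A b i T <= gap i j.
Proof.
move=> jT; have T0 : T != set0 by apply/set0Pn; exists j.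
have [_ /(_ j jT)] := fmaxP (fun j => A i j + principal A b j 0) T0.
by rewrite /err_nonempty /gap; lra.
Qed.

Lemma err_nonempty_attained i {T} :
  T != set0 -> exists2 j, j \in T & err_nonempty A b i T = gap i j.
Proof.
move=> T0; have [[j jT Ej] _] := fmaxP (fun j => A i j + principal A b j 0) T0.
by exists j => //; rewrite /err_nonempty Ej opprD addrA.
Qed.

Lemma err_nonempty1 i j : err_nonempty A b i [set j] = gap i j.
Proof.
have j0 : [set j] != set0 by apply/set0Pn; exists j; rewrite inE.
by have [j' /set1P -> ->] := err_nonempty_attained i j0.
Qed.

Lemma err_le i {T j} : j \in T -> err A b i T <= gap i j.
Proof.
move=> jT; rewrite /err; case: eqP => [T0|_]; last exact: err_nonempty_le.
by rewrite T0 inE in jT.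
Qed.

Lemma gap_le_err0 i j : gap i j <= err A b i set0.
Proof.
have n0 : [set: 'I_n] != set0 by apply/set0Pn; exists j; rewrite inE.
rewrite /err eqxx -err_nonempty1.
by have [_] := fmaxP (fun j => err_nonempty A b i [set j]) n0; apply; rewrite inE.
Qed.

Lemma err_attained i {T} :
  T != set0 -> exists2 j, j \in T & err A b i T = gap i j.
Proof.
by move=> T0; rewrite /err (negPf T0); exact: err_nonempty_attained.
Qed.

Lemma err0_attained i : (0 < n)%N -> exists j, err A b i set0 = gap i j.
Proof.
move=> hn; have n0 : [set: 'I_n] != set0.
  by apply/set0Pn; exists (Ordinal hn); rewrite inE.
rewrite /err eqxx.
have [[j _ ->] _] := fmaxP (fun j => err_nonempty A b i [set j]) n0.
by exists j; rewrite err_nonempty1.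
Qed.

Lemma err_ge0 i T : (0 < n)%N -> 0 <= err A b i T.
Proof.
move=> hn; have [->|/(err_attained i)[j _ ->]] := eqVneq T set0.
  by have [j ->] := err0_attained i hn; exact: gap_ge0.
exact: gap_ge0.
Qed.

Lemma err_setU1 i j T : err A b i (j |: T) <= err A b i T.
Proof.
have [->|/(err_attained i)[j' j'T ->]] := eqVneq T set0.
  by apply: le_trans (gap_le_err0 i j); apply: err_le; rewrite !inE eqxx.
by apply: err_le; rewrite !inE j'T orbT.
Qed.

Lemma powR_err_le p i S T : (0 < n)%N -> 0 < p ->
  err A b i S <= err A b i T -> err A b i S `^ p <= err A b i T `^ p.
Proof.
by move=> hn p0; apply: (ge0_ler_powR (ltW p0)); rewrite nnegrE err_ge0.
Qed.

Lemma total_err_setU1 p j T : 0 < p ->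
  total_err A b p (j |: T) <= total_err A b p T.
Proof.
move=> p0; apply: ler_sum => i _; apply: powR_err_le => //.
  exact: leq_ltn_trans (ltn_ord j).
exact: err_setU1.
Qed.

(** In each row one element of [S], a minimiser of the gap, accounts alone for
    the whole drop; the other summands only add nonnegative amounts.  As the
    argument only compares errors, it survives the monotone map [`^ p] for
    every p > 0, with no convexity involved. *)
Lemma total_err_drop p S T : 0 < p -> S != set0 ->
  total_err A b p T - total_err A b p S
    <= \sum_(j in S) (total_err A b p T - total_err A b p (j |: T)).
Proof.
move=> p0 S0; have [j0 j0S] := set0Pn _ S0.
have hn : (0 < n)%N by exact: leq_ltn_trans (ltn_ord j0).
under eq_bigr => j _ do rewrite -sumrB.
rewrite exchange_big -sumrB /=; apply: ler_sum => i _.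
have [j jS Ej] := err_attained i S0.
rewrite (bigD1 j)//=; apply: ler_wpDr.
  by apply: sumr_ge0 => j' _; rewrite subr_ge0 powR_err_le ?err_setU1.
rewrite lerB// powR_err_le// Ej; apply: err_le.
by rewrite !inE eqxx.
Qed.

Lemma total_err0_le p : (0 < n)%N -> 0 < p ->
  total_err A b p set0 <= m%:R * max_gap A b `^ p.
Proof.
move=> hn p0; rewrite mulr_natl.
have -> : max_gap A b `^ p *+ m = \sum_(i < m) max_gap A b `^ p.
  by rewrite sumr_const card_ord.
apply: ler_sum => i _; have [j Ej] := err0_attained i hn.
have le : err A b i set0 <= max_gap A b by rewrite Ej gap_le_max_gap.
have e0 := err_ge0 i set0 hn.
by apply: (ge0_ler_powR (ltW p0)); rewrite ?nnegrE ?(le_trans e0 le).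
Qed.

Lemma pnorm_pow_term_le p (v : 'cV[\bar R]_m) i :
  (`|v i 0%R| `^ p <= pnorm_pow p v)%E.
Proof.
rewrite /pnorm_pow (bigD1 i)//= leeDl//; apply: sume_ge0 => *.
exact: poweR_ge0.
Qed.

(** A x <= b forces every entry of [x] below the principal solution, whose
    entries on the support of [x] therefore leave the smaller residual. *)
Lemma err_supp_le_residual {x : 'cV[\bar R]_n} i : in_Rmax x ->
  (forall i', maxplus_mul A x i' 0%R <= (b i' 0%R)%:E)%E ->
  ((err A b i (supp x))%:E <= (b i 0%R)%:E - maxplus_mul A x i 0%R)%E.
Proof.
move=> xRmax Axb.
have le_entry i' j : ((A i' j)%:E + x j 0%R <= maxplus_mul A x i' 0%R)%E.
  by rewrite mxE; exact: (le_bigmax _ (fun j => (A i' j)%:E + x j 0%R)%E).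
suff H : (maxplus_mul A x i 0%R <= (b i 0%R - err A b i (supp x))%:E)%E.
  apply: le_trans (leeB (lexx _) H).
  by rewrite -EFinB lee_fin opprB addrC subrK.
rewrite mxE; apply: bigmax_le => [|j _]; first exact: leNye.
case Ex: (x j 0) => [r| |]; last by rewrite leNye.
  have jx : j \in supp x by rewrite inE Ex.
  have m0 : [set: 'I_m] != set0 by apply/set0Pn; exists i; rewrite inE.
  have rle : r <= principal A b j 0.
    rewrite mxE; have [[i' _ ->] _] := fminP (fun i => b i 0 - A i j) m0.
    by have := le_trans (le_entry i' j) (Axb i'); rewrite Ex lee_fin; lra.
  by rewrite -EFinD lee_fin; have := err_le i jx; rewrite /gap; lra.
by have := xRmax j; rewrite Ex eqxx.
Qed.

(** Nonemptiness comes from the norm bound: the vector with no finite entry has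
    an infinite residual, hence an infinite norm. *)
Lemma feasible_supp p eps {x : 'cV[\bar R]_n} : (0 < m)%N -> (0 < n)%N -> 0 < p ->
  feasible A b p eps x ->
  supp x != set0 /\ total_err A b p (supp x) <= eps.
Proof.
move=> hm hn p0 [xRmax bound Axb]; split.
  apply/eqP => x0; have xE j : x j 0 = -oo%E.
    by apply/eqP; have := in_set0 j; rewrite -x0 inE => /negbFE.
  have AxE i : maxplus_mul A x i 0 = -oo%E.
    by rewrite mxE big1// => j _; rewrite xE.
  have := le_trans (pnorm_pow_term_le p _ (Ordinal hm)) bound.
  by rewrite mxE AxE /= gt_eqF.
rewrite -lee_fin; apply: le_trans bound; rewrite /total_err -sumEFin.
apply: lee_sum => i _; have e0 := err_ge0 i (supp x) hn.
have le_i := err_supp_le_residual i xRmax Axb.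
have v0 := le_trans _ le_i; rewrite mxE gee0_abs ?v0 ?lee_fin//.
rewrite -poweR_EFin; apply: (gt0_ler_poweR (ltW p0)) => //;
  by rewrite in_itv /= leey andbT ?v0 ?lee_fin.
Qed.

(** Chosen by [total_err_drop], the best single addition realises at least the
    average, over the elements of [S], of the drop from [T] to [S].  An element
    of [S] already in [T] contributes no drop at all. *)
Lemma greedy_step_drop {p eps S T T'} : 0 < p -> S != set0 ->
  greedy_step A b p eps T T' ->
  total_err A b p T - total_err A b p S
    <= #|S|%:R * (total_err A b p T - total_err A b p T').
Proof.
move=> p0 S0 [_ [j jT [best ->]]]; apply: le_trans (total_err_drop _ _ _ p0 S0) _.
rewrite mulr_natl -sumr_const; apply: ler_sum => s _.
have [sT|sT] := boolP (s \in T); last by rewrite lerB// best.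
by rewrite (setUidPr _) ?sub1set// subrr subr_ge0 total_err_setU1.
Qed.

Lemma card_greedy {p eps k} {Ts : nat -> {set 'I_n}} : Ts 0%N = set0 ->
  (forall l, (l < k)%N -> greedy_step A b p eps (Ts l) (Ts l.+1)) ->
  #|Ts k| = k.
Proof.
move=> T0 step; suff H l : (l <= k)%N -> #|Ts l| = l by exact: H.
elim: l => [|l IH] lk; first by rewrite T0 cards0.
by have [_ [j jT [_ ->]]] := step l lk; rewrite cardsU1 jT IH// ltnW.
Qed.

End Errors.

Theorem proposition3 (R : realType) (m n : nat) (hm : (1 <= m)%N) (hn : (1 <= n)%N)
    (A : 'M[R]_(m, n)) (b : 'cV[R]_m) (p eps : R) (hp : 0 < p) (heps : 0 <= eps)
    (T : nat -> {set 'I_n}) (k : nat) (x : 'cV[\bar R]_n)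
    (hgreedy : greedy_returns A b p eps T k x) (hk : (0 < k)%N)
    (xstar : 'cV[\bar R]_n) (hstar : optimal A b p eps xstar)
    (Tstar : {set 'I_n}) (hTstar : Tstar = supp xstar) :
  #|T k|%:R / #|Tstar|%:R <=
    1 + ln ((m%:R * max_gap A b `^ p - eps) / (total_err A b p (T k.-1) - eps)).
Proof.
case: hgreedy => _ T0 step _ _; case: hstar => feas _.
have [S0 Seps] := feasible_supp A b p eps hm hn hp feas.
rewrite -hTstar in S0 Seps; rewrite (card_greedy A b T0 step).
have t1 : 1 <= #|Tstar|%:R :> R by rewrite ler1n card_gt0.
set t : R := #|Tstar|%:R in t1 *; have t0 : 0 < t by lra.
pose d l := total_err A b p (T l) - eps.
have dpos l : (l < k)%N -> 0 < d l by move=> /step[]; rewrite subr_gt0.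
have dstep l : (l.+1 < k)%N -> d l <= t * (d l - d l.+1).
  move=> /ltnW/step/(greedy_step_drop A b hp S0); rewrite -/t /d.
  by rewrite opprB addrA subrK; lra.
have k1k : (k.-1 < k)%N by rewrite prednK.
have := ln_decay R d t k t0 dpos dstep k.-1 k1k.
have d0 := dpos _ hk; have dk := dpos _ k1k; rewrite -/(d k.-1).
have d0le : d 0%N <= m%:R * max_gap A b `^ p - eps.
  by rewrite /d T0 lerB// total_err0_le.
have c0 := lt_le_trans d0 d0le.
rewrite ln_div ?posrE//.
have : ln (d 0%N) <= ln (m%:R * max_gap A b `^ p - eps) by rewrite ler_ln ?posrE.
have : t^-1 <= 1 by rewrite invf_le1.
have -> : k%:R / t = k.-1%:R / t + t^-1.
  by rewrite -{1}(prednK hk) -natr1 mulrDl mul1r.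
lra.
Qed.
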